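(* There does not exist a totally $T$-adic function over $\mathbb{F}_2(T)$ with height $1/3$ and gonality $2$, $3$, or $4$.
   Context: $\mathbb{F}_2(T)$ is the rational function field over the field with two elements, $\overline{\mathbb{F}_2(T)}$ a fixed algebraic closure, and $\mathbb{F}_2((T))$ the field of formal Laurent series. The minimal polynomial of $\alpha\in\overline{\mathbb{F}_2(T)}$ is the unique polynomial $f\in\mathbb{F}_2[T][x]$ that is irreducible over $\mathbb{F}_2(T)$ as a polynomial in $x$, satisfies $f(\alpha)=0$, and has coefficients in $\mathbb{F}_2[T]$ with no common factor. The height is $h(\alpha)=\deg_T(f)/\deg_x(f)$. A totally $T$-adic function over $\mathbb{F}_2(T)$ is an $\alpha\in\overline{\mathbb{F}_2(T)}$ whose minimal polynomial splits completely over $\mathbb{F}_2((T))$. The gonality of a curve $X/\mathbb{F}_2$ is the minimum degree of a nonconstant $\mathbb{F}_2$-morphism $X\to\mathbb{P}^1$; the gonality of $\alpha$ is the gonality of the smooth proper curve over $\mathbb{F}_2$ with function field $\mathbb{F}_2(T,\alpha)$. *)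

(* Defs.v *)
From HB Require Import structures.
From mathcomp Require Import all_boot all_order all_algebra.
From mathcomp Require Import boolp.

Set Implicit Arguments.
Unset Strict Implicit.
Unset Printing Implicit Defensive.

Import GRing.Theory.
Local Open Scope ring_scope.

Record powerSeries (F : fieldType) := PowerSeries { pscoef : nat -> F }.

HB.instance Definition _ (F : fieldType) := gen_eqMixin (powerSeries F).
HB.instance Definition _ (F : fieldType) := gen_choiceMixin (powerSeries F).

Section PowerSeries.
Variable F : fieldType.
Implicit Types f g h : powerSeries F.

Lemma psP f g : pscoef f =1 pscoef g -> f = g.
Proof. by case: f g => [a] [b] /= eqab; congr PowerSeries; apply/funext. Qed.

Definition ps0 := PowerSeries (fun=> 0 : F).
Definition ps_opp f := PowerSeries (fun n => - pscoef f n).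
Definition ps_add f g := PowerSeries (fun n => pscoef f n + pscoef g n).

Lemma ps_addA : associative ps_add.
Proof. by move=> f g h; apply: psP => n /=; rewrite addrA. Qed.
Lemma ps_addC : commutative ps_add.
Proof. by move=> f g; apply: psP => n /=; rewrite addrC. Qed.
Lemma ps_add0 : left_id ps0 ps_add.
Proof. by move=> f; apply: psP => n /=; rewrite add0r. Qed.
Lemma ps_addN : left_inverse ps0 ps_opp ps_add.
Proof. by move=> f; apply: psP => n /=; rewrite addNr. Qed.

HB.instance Definition _ :=
  GRing.isZmodule.Build (powerSeries F) ps_addA ps_addC ps_add0 ps_addN.

Definition ps1 := PowerSeries (fun n => (n == 0)%N%:R : F).
Definition ps_mul f g :=
  PowerSeries (fun n => \sum_(i < n.+1) pscoef f i * pscoef g (n - i)%N).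

Definition ps_trunc N f : {poly F} := \poly_(i < N) pscoef f i.

Lemma ps_mul_trunc N f g n : (n < N)%N ->
  pscoef (ps_mul f g) n = (ps_trunc N f * ps_trunc N g)`_n.
Proof.
move=> ltnN; rewrite coefM /=; apply: eq_bigr => i _.
by rewrite !coef_poly (leq_ltn_trans (leq_ord i) ltnN)
  (leq_ltn_trans (leq_subr i n) ltnN).
Qed.

Lemma ps_mulC : commutative ps_mul.
Proof. by move=> f g; apply: psP => n; rewrite !(@ps_mul_trunc n.+1) // mulrC. Qed.

Lemma ps_mulA : associative ps_mul.
Proof.
move=> f g h; apply: psP => n.
transitivity ((ps_trunc n.+1 f * (ps_trunc n.+1 g * ps_trunc n.+1 h))`_n).
  rewrite coefM; apply: eq_bigr => i _.
  by rewrite coef_poly ltn_ord -ps_mul_trunc // ltnS leq_subr.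
rewrite mulrA coefM; apply: eq_bigr => i _.
by rewrite [X in _ * X]coef_poly ltnS leq_subr -ps_mul_trunc.
Qed.

Lemma ps_mul1 : left_id ps1 ps_mul.
Proof.
move=> f; apply: psP => n /=.
rewrite big_ord_recl /= mul1r subn0 big1 ?addr0 // => i _.
by rewrite mul0r.
Qed.

Lemma ps_mulDl : left_distributive ps_mul ps_add.
Proof.
move=> f g h; apply: psP => n /=; rewrite -big_split /=.
by apply: eq_bigr => i _; rewrite mulrDl.
Qed.

Lemma ps1_neq0 : ps1 != 0.
Proof.
apply/eqP => /(congr1 (fun f => pscoef f 0)) /= /eqP.
by rewrite oner_eq0.
Qed.

HB.instance Definition _ := GRing.Zmodule_isComNzRing.Build (powerSeries F)
  ps_mulA ps_mulC ps_mul1 ps_mulDl ps1_neq0.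

(* The first n coefficients of the inverse of f. *)
Fixpoint ps_inv_seq f n : seq F :=
  if n is m.+1 then
    let s := ps_inv_seq f m in
    rcons s ((pscoef f 0)^-1 *
             ((m == 0)%N%:R - \sum_(i < m) s`_i * pscoef f (m - i)%N))
  else [::].

Definition ps_unit : {pred powerSeries F} := fun f => pscoef f 0 != 0.

Definition ps_inv f :=
  if ps_unit f then PowerSeries (fun n => (ps_inv_seq f n.+1)`_n) else f.

Lemma size_ps_inv_seq f n : size (ps_inv_seq f n) = n.
Proof. by elim: n => //= n IHn; rewrite size_rcons IHn. Qed.

Lemma nth_ps_inv_seq f m n : (m < n)%N ->
  (ps_inv_seq f n)`_m = (ps_inv_seq f m.+1)`_m.
Proof.
elim: n => // n IHn; rewrite ltnS leq_eqVlt => /predU1P[-> //| ltmn].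
by rewrite -(IHn ltmn) /= nth_rcons size_ps_inv_seq ltmn.
Qed.

Lemma ps_mulV : {in ps_unit, left_inverse 1 ps_inv *%R}.
Proof.
move=> f Uf; have f0 : pscoef f 0 != 0 by [].
apply: psP => n; rewrite /ps_inv [ps_unit f]Uf.
change (\sum_(i < n.+1) (ps_inv_seq f i.+1)`_i * pscoef f (n - i)%N
  = (n == 0)%N%:R).
rewrite big_ord_recr /= subnn nth_rcons size_ps_inv_seq ltnn eqxx.
rewrite mulrAC mulVf // mul1r addrC.
apply/(canLR (subrK _)); congr (_ - _); apply: eq_bigr => i _.
by rewrite (@nth_ps_inv_seq f i n).
Qed.

Lemma ps_unitPl f g : g * f = 1 -> ps_unit f.
Proof.
move=> /(congr1 (fun h => pscoef h 0)) /=.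
rewrite big_ord1 => gf1; apply/eqP => f0.
by move: gf1; rewrite f0 mulr0 => /esym/eqP; rewrite oner_eq0.
Qed.

Lemma ps_inv_out : {in [predC ps_unit], ps_inv =1 id}.
Proof. by move=> f; rewrite /ps_inv => /negPf /= nUf; rewrite [ps_unit f]nUf. Qed.

HB.instance Definition _ := GRing.ComNzRing_hasMulInverse.Build (powerSeries F)
  ps_mulV ps_unitPl ps_inv_out.

Lemma ps_lead f : f != 0 ->
  exists2 m, pscoef f m != 0 & forall i, (i < m)%N -> pscoef f i = 0.
Proof.
move=> fn0; have ex_m : exists m, pscoef f m != 0.
  apply: contrapT => /forallNP f0; case/eqP: fn0; apply: psP => n.
  by have /negP := f0 n; rewrite negbK => /eqP.
exists (ex_minn ex_m); case: ex_minnP => // m _ minm i ltim.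
by apply/eqP; apply: contraLR ltim => /minm; rewrite -leqNgt.
Qed.

Lemma ps_mulf_eq0 : GRing.integral_domain_axiom (powerSeries F).
Proof.
move=> f g fg0; apply/norP => -[/ps_lead[m fm fm0] /ps_lead[k gk gk0]].
move/(congr1 (fun h => pscoef h (m + k)%N)): fg0 => /=.
have ltm : (m < (m + k).+1)%N by rewrite ltnS leq_addr.
rewrite (bigD1 (Ordinal ltm)) //= addKn big1 => [|i neim].
  by rewrite addr0 => /eqP; rewrite mulf_eq0 (negPf fm) (negPf gk).
have [ltim|ltmi|eqim] := ltngtP i m.
- by rewrite fm0 ?mul0r.
- by rewrite gk0 ?mulr0 // -(ltn_add2l i) subnKC ?ltn_add2r // -ltnS.
- by case/eqP: neim; apply: val_inj.
Qed.

HB.instance Definition _ :=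
  GRing.ComUnitRing_isIntegral.Build (powerSeries F) ps_mulf_eq0.

Definition poly_ps (p : {poly F}) : powerSeries F :=
  PowerSeries (fun n => p`_n).

Lemma poly_ps_is_zmod_morphism : zmod_morphism poly_ps.
Proof. by move=> p q; apply: psP => n /=; rewrite coefB. Qed.
Lemma poly_ps_is_monoid_morphism : monoid_morphism poly_ps.
Proof.
by split=> [|p q]; apply: psP => n /=; rewrite ?coef1 ?coefM.
Qed.

HB.instance Definition _ := GRing.isZmodMorphism.Build {poly F} (powerSeries F)
  poly_ps poly_ps_is_zmod_morphism.
HB.instance Definition _ := GRing.isMonoidMorphism.Build {poly F}
  (powerSeries F) poly_ps poly_ps_is_monoid_morphism.

End PowerSeries.

(* F((T)), as the fraction field of F[[T]]; laurentP shows that its elements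
   are exactly the series T^-n f with f in F[[T]]. *)
Notation laurent F := {fraction (powerSeries F)}.

Definition poly_laurent (F : fieldType) : {poly F} -> laurent F :=
  @tofrac (powerSeries F) \o @poly_ps F.

HB.instance Definition _ (F : fieldType) :=
  GRing.RMorphism.copy (@poly_laurent F) (@tofrac (powerSeries F) \o @poly_ps F).

Lemma laurentP (F : fieldType) (z : laurent F) :
  exists n (f : powerSeries F), z = tofrac f / poly_laurent 'X ^+ n.
Proof.
have [a [b [bn0 ->]]] : exists a b : powerSeries F,
    b != 0 /\ z = tofrac a / tofrac b.
  elim/quotW: z => r; exists (\n_r), (\d_r).
  have dn0 : \d_r != 0 by exact: denom_ratioP.
  split=> //; apply/(canRL (mulfK _)); first by rewrite tofrac_eq0.
  unlock tofrac; rewrite -[LHS]FracField.pi_mul; apply/eqmodP.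
  rewrite /= FracField.equivfE /FracField.mulf.
  by rewrite !numden_Ratio ?oner_eq0 ?mulr1 // mulrC.
have [n bn bn0'] := ps_lead bn0.
pose u := PowerSeries (fun i => pscoef b (n + i)%N).
have Uu : u \is a GRing.unit by rewrite unfold_in /= /ps_unit /= addn0.
have eb : b = u * poly_ps 'X ^+ n.
  rewrite -rmorphXn mulrC; apply: psP => i /=.
  under eq_bigr do rewrite coefXn.
  have [leni|ltin] := leqP n i; last first.
    rewrite bn0' // big1 // => j _; rewrite (_ : (_ == n)%N = false) ?mul0r //.
    by apply/negbTE; rewrite neq_ltn (leq_trans _ ltin) // ltn_ord.
  have ltni : (n < i.+1)%N by [].
  rewrite (bigD1 (Ordinal ltni)) //= eqxx mul1r subnKC // big1 ?addr0 // => j.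
  by rewrite -val_eqE /= => /negPf ->; rewrite mul0r.
exists n, (a / u).
have un0 : tofrac u != 0.
  by rewrite tofrac_eq0; apply: contraTneq Uu => ->; rewrite unitr0.
rewrite eb tofracM invfM mulrA tofracXn; congr (_ / _).
by apply/(canLR (mulfK un0)); rewrite -tofracM divrK.
Qed.

Notation F2T := {fraction {poly 'F_2}}.
Definition varT : F2T := tofrac ('X : {poly 'F_2}).

Section TotallyTadic.

(* L is an extension of F_2(T) along iota. In {poly {poly 'F_2}} = F_2[T][x],
   the outer variable is x and the inner one is T. *)
Variables (L : fieldType) (iota : {rmorphism F2T -> L}).
Implicit Types (alpha : L) (f : {poly {poly 'F_2}}).

Definition is_minimal_polynomial alpha f :=
  let f_rat := map_poly (@tofrac {poly 'F_2}) f in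
  [/\ irreducible_poly f_rat,
      root (map_poly iota f_rat) alpha
    & forall d : {poly 'F_2}, (forall i, d %| f`_i) -> size d = 1%N].

Definition degx f : nat := (size f).-1.
Definition degT f : nat := (\max_(i < size f) size (f`_i)%R)%N.-1.

Definition has_height alpha (h : rat) :=
  exists2 f, is_minimal_polynomial alpha f & h = (degT f)%:R / (degx f)%:R.

Definition splits_completely (K : fieldType) (p : {poly K}) :=
  exists rs : seq K, p %= \prod_(r <- rs) ('X - r%:P).

Definition totally_Tadic alpha :=
  exists2 f, is_minimal_polynomial alpha f
    & splits_completely (map_poly (@poly_laurent 'F_2) f).

(* The subfield of L generated by s, i.e. the smallest subfield containing s;
   it contains the prime field F_2, so this is F_2(s). *)
Definition gen_subfield (s : seq L) : L -> Prop := fun y =>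
  forall S : {pred L}, divring_closed S -> {subset s <= S} -> y \in S.

(* [K : k] = n, for subfields k and K of L with k contained in K. *)
Definition ext_degree (k K : L -> Prop) (n : nat) :=
  exists2 b : 'I_n -> L, (forall i, K (b i)) &
    forall y, K y -> exists! c : {ffun 'I_n -> L},
      (forall i, k (c i)) /\ y = \sum_(i < n) c i * b i.

Definition constF2 (c : 'F_2) : L := iota (tofrac c%:P).

(* A nonconstant F_2-morphism to P^1 from the smooth proper curve X with
   function field K is a rational function u on X (the pullback of the
   coordinate of P^1) that is transcendental over F_2; its degree is, by
   definition, the degree [K : F_2(u)] of the extension of function fields. *)
Definition has_morphism_of_degree (K : L -> Prop) (n : nat) :=
  exists u, [/\ K u, ~ algebraicOver constF2 u
              & ext_degree (gen_subfield [:: u]) K n].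

Definition has_gonality alpha (n : nat) :=
  let K := gen_subfield [:: iota varT; alpha] in
  has_morphism_of_degree K n /\
  forall m, has_morphism_of_degree K m -> (n <= m)%N.

End TotallyTadic.

(* Main.v *)
From HB Require Import structures.
Require Import Defs.
From mathcomp Require Import all_boot all_order all_algebra.
From mathcomp Require Import boolp ring zify.

(** If alpha is totally T-adic of height 1/3, then T is a rational function of
    alpha, namely one of
    (x^2 + x) / (x^3 + x + 1), (x^2 + x) / (x^3 + x^2 + 1) at x = alpha.  Hence
    F_2(T, alpha) = F_2(alpha) has gonality 1.

    On the curve X with function field F_2(T, alpha), let d be the degree of
    alpha, so that T has degree 3d.  Total T-adicity says that the zeros of T
    are 3d distinct F_2-rational points.  At each of them alpha takes one of the
    three values 0, 1, oo, and each value is taken at most d times; so the three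
    fibres of alpha consist of these 3d points, and are unramified.  Let
    u = (alpha^2 + alpha) / (alpha^3 + alpha + 1).  Both u and T have their
    zeros exactly at the 3d points, all of them simple, and u / T takes the
    value 1 there because 1 is the only nonzero element of F_2.  Therefore
    1/u - 1/T has no pole: it is a constant, 0 or 1.  These two cases are the
    two formulas above.

    The proof below carries this out with polynomials and power series only.
    Let f(T, x) be the minimal polynomial of alpha.  Over F_2[[T]] it factors as
    C * prod (b x - a) with (a : b) in lowest terms (splits_primitive), and
    counting T-adic valuations of f(T, 0), f(T, 1) and of the leading
    coefficient gives the statement on fibres (sum_reduces_to,
    reduces_to_uniformizer).  Write Q for one of the two cubics and
    u = (x^2 + x) / Q.  The polynomial Q^d f(u(x), x) has degree at most 6d,
    and substituting T = u(x) in the factorization shows that it vanishes to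
    order 2d at each of 0, 1, oo (chart_order): this makes it a constant multiple
    of (x^2 + x)^(2d).  For one of the two choices of Q the order at 0 is larger
    (chart_order3), so the polynomial is zero (hsubst_eq0).  Thus f and
    T Q(x) - (x^2 + x) have a common zero over F_2(x), their resultant vanishes
    (resultant_graph_eq0), and alpha is a root of T Q(x) - (x^2 + x). *)

Set Implicit Arguments.
Unset Strict Implicit.
Unset Printing Implicit Defensive.

Import GRing.Theory.
Local Open Scope ring_scope.

(** * Evaluation of homogenized polynomials *)

Section HomogeneousEvaluation.
Variable S : comNzRingType.
Implicit Types (f g : {poly S}) (p q : S).

(** The value at (p : q) of f regarded as a binary form of degree n.  Points at
    infinity of the x-line are treated like the others in this way. *)
Definition hev n f p q : S := \sum_(j < n.+1) f`_j * p ^+ j * q ^+ (n - j).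

Lemma hev_sum n (I : Type) (r : seq I) (G : I -> {poly S}) p q :
  hev n (\sum_(i <- r) G i) p q = \sum_(i <- r) hev n (G i) p q.
Proof.
rewrite /hev exchange_big; apply: eq_bigr => j _ /=.
by rewrite coef_sum !mulr_suml.
Qed.

Lemma hevZ n a f p q : hev n (a *: f) p q = a * hev n f p q.
Proof. by rewrite mulr_sumr; apply: eq_bigr => j _; rewrite coefZ -!mulrA. Qed.

Lemma hevXn n k p q : (k <= n)%N -> hev n 'X^k p q = p ^+ k * q ^+ (n - k).
Proof.
rewrite -ltnS => ltkn; rewrite /hev (bigD1 (Ordinal ltkn)) //= coefXn eqxx mul1r.
rewrite big1 ?addr0 // => j; rewrite -val_eqE /= coefXn => /negPf ->.
by rewrite !mul0r.
Qed.

Lemma poly_sumXn n f : (size f <= n)%N -> f = \sum_(i < n) f`_i *: 'X^i.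
Proof.
move=> szf; apply/polyP => k; rewrite coef_sum.
under eq_bigr do rewrite coefZ coefXn.
have [ltkn|lenk] := ltnP k n; last first.
  rewrite nth_default ?(leq_trans szf) // big1 // => i _.
  by rewrite gtn_eqF ?mulr0 // (leq_trans _ lenk).
rewrite (bigD1 (Ordinal ltkn)) //= eqxx mulr1 big1 ?addr0 // => i.
by rewrite -val_eqE /= eq_sym => /negPf ->; rewrite mulr0.
Qed.

Lemma hevM m n f g p q : (size f <= m.+1)%N -> (size g <= n.+1)%N ->
  hev (m + n) (f * g) p q = hev m f p q * hev n g p q.
Proof.
move=> /poly_sumXn {1}-> /poly_sumXn {1}->.
rewrite big_distrlr hev_sum [RHS]big_distrlr; apply: eq_bigr => i _ /=.
rewrite hev_sum; apply: eq_bigr => j _.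
have le_i := leq_ord i; have le_j := leq_ord j.
rewrite -scalerAl -scalerAr -exprD !hevZ hevXn ?leq_add //.
have -> : (m + n - (i + j) = (m - i) + (n - j))%N by lia.
by rewrite !exprD; ring.
Qed.

Lemma hevC a p q : hev 0 a%:P p q = a.
Proof. by rewrite /hev big_ord1 coefC !expr0 !mulr1. Qed.

Lemma size_expXl m f k : (size f <= m.+1)%N -> (size (f ^+ k) <= (m * k).+1)%N.
Proof.
move=> szf; elim: k => [|k IHk]; first by rewrite expr0 muln0 size_poly1.
rewrite exprS; apply: leq_trans (size_polyMleq _ _) _; rewrite mulnS.
by move: szf IHk; lia.
Qed.

Lemma hevX m k f p q : (size f <= m.+1)%N ->
  hev (m * k) (f ^+ k) p q = hev m f p q ^+ k.
Proof.
move=> szf; elim: k => [|k IHk]; first by rewrite muln0 !expr0 hevC.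
by rewrite mulnS !exprS hevM ?IHk ?size_expXl.
Qed.

Lemma hev1r n f p : (size f <= n.+1)%N -> hev n f p 1 = f.[p].
Proof.
move=> szf; rewrite (horner_coef_wide _ szf); apply: eq_bigr => j _.
by rewrite expr1n mulr1.
Qed.

Lemma hev_prod (rs : seq (S * S)) p q :
  hev (size rs) (\prod_(r <- rs) (r.2 *: 'X - r.1%:P)) p q =
    \prod_(r <- rs) (r.2 * p - r.1 * q).
Proof.
have szl r : (size (r.2 *: 'X - r.1%:P : {poly S})%R <= 2)%N.
  apply: leq_trans (size_polyD _ _) _; rewrite size_polyN geq_max.
  rewrite (leq_trans (size_scale_leq _ _)) ?size_polyX //.
  by rewrite (leq_trans (size_polyC_leq1 _)).
elim: rs => [|r rs IHrs]; first by rewrite !big_nil hevC.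
rewrite !big_cons /= -add1n hevM //.
  rewrite IHrs; congr (_ * _).
  rewrite /hev 2!big_ord_recl big_ord0 /= !coefB !coefZ !coefX !coefC /=.
  by rewrite /bump /= subn0 subnn; ring.
elim: rs {IHrs} => [|r' rs IHrs]; first by rewrite big_nil size_poly1.
rewrite big_cons; apply: leq_trans (size_polyMleq _ _) _ => /=.
rewrite -subn1 leq_subLR -[leqRHS]/((2 + (size rs).+1)%N).
by rewrite leq_add.
Qed.
End HomogeneousEvaluation.

Lemma hev_map (S S' : comNzRingType) (phi : {rmorphism S -> S'}) n f p q :
  phi (hev n f p q) = hev n (map_poly phi f) (phi p) (phi q).
Proof.
rewrite /hev rmorph_sum; apply: eq_bigr => j _ /=.
by rewrite !rmorphM !rmorphXn coef_map.
Qed.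

(** * Substituting a rational function for T *)

Section Substitution.
Variables (K : comNzRingType) (d m n : nat) (f : {poly {poly K}}) (D Q : {poly K}).
Hypothesis size_coef : forall j, (size (f`_j)%R <= d.+1)%N.
Hypotheses (szD : (size D <= m.+1)%N) (szQ : (size Q <= m.+1)%N).

(** For f of degree at most n in its outer variable x and at most d in its inner
    variable T, this is Q^d f(D / Q, x), freed from denominators. *)
Definition hsubst : {poly K} :=
  \sum_(j < n.+1) hev d (map_poly polyC f`_j) D Q * 'X^j.

Lemma size_exp_mul k : (k <= d)%N ->
  (size (D ^+ k * Q ^+ (d - k))%R <= (m * d).+1)%N.
Proof.
move=> lekd; apply: leq_trans (size_polyMleq _ _) _.
have := size_expXl k szD; have := size_expXl (d - k) szQ.
by have -> : (m * d = m * k + m * (d - k))%N; [rewrite -mulnDr subnKC | lia].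
Qed.

Lemma size_hev_polyC j :
  (size (hev d (map_poly polyC f`_j) D Q) <= (m * d).+1)%N.
Proof.
rewrite /hev; apply: leq_trans (size_sum _ _ _) _.
apply/bigmax_leqP => k _; rewrite coef_map /= -mulrA mul_polyC.
by apply: leq_trans (size_scale_leq _ _) (size_exp_mul _); rewrite -ltnS.
Qed.

Lemma size_hsubst : (size hsubst <= (m * d + n).+1)%N.
Proof.
apply: leq_trans (size_sum _ _ _) _; apply/bigmax_leqP => j _.
apply: leq_trans (size_polyMleq _ _) _; rewrite size_polyXn addnS /= -addSn.
by rewrite leq_add ?size_hev_polyC ?leq_ord.
Qed.

(** If psi sends T to the value of D / Q at the point (X : Y), then hsubst at
    (X : Y) can be computed by applying psi to the coefficients of f first.  This
    is what gives access to a factorization of f over a ring where psi extends. *)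
Lemma hev_hsubst (S : comNzRingType) (c : {rmorphism K -> S})
    (psi : {rmorphism {poly K} -> S}) (X Y : S) :
    (forall k, psi k%:P = c k) ->
    psi 'X * hev m (map_poly c Q) X Y = hev m (map_poly c D) X Y ->
  hev (m * d + n) (map_poly c hsubst) X Y =
    hev m (map_poly c Q) X Y ^+ d * hev n (map_poly psi f) X Y.
Proof.
move=> psiC psiX; rewrite rmorph_sum hev_sum mulr_sumr.
have szc (P : {poly K}) k : (size P <= k -> size (map_poly c P) <= k)%N.
  by apply: leq_trans; apply: size_poly.
apply: eq_bigr => -[j /= ltjn] _.
rewrite rmorphM /= map_polyXn hevM; last 2 first.
- by rewrite szc ?size_hev_polyC.
- by rewrite size_polyXn.
rewrite hevXn // coef_map !mulrA; congr (_ * _ * _).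
have psi_f : psi f`_j = \sum_(k < d.+1) c f`_j`_k * psi 'X ^+ k.
  rewrite [in LHS](poly_sumXn (size_coef j)) rmorph_sum; apply: eq_bigr => k _.
  by rewrite -mul_polyC rmorphM rmorphXn psiC.
rewrite [X in _ = _ * X]psi_f mulr_sumr [hev d _ _ _]/hev rmorph_sum hev_sum.
apply: eq_bigr => -[k /= ltk] _.
rewrite coef_map /= -mulrA !rmorphM /= map_polyC !rmorphXn /= mul_polyC hevZ.
have -> : (m * d = m * k + m * (d - k))%N by rewrite -mulnDr subnKC.
rewrite hevM ?hevX ?size_expXl ?szc //.
rewrite -psiX exprMn -[in X in _ = X * _](subnKC (ltnSE ltk)) exprD.
by rewrite /=; ring.
Qed.
End Substitution.

(** * Orders of vanishing and composition of power series *)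

Section PowerSeriesOrder.
Variable F : fieldType.
Implicit Types (f g V : powerSeries F) (p : {poly F}).

Definition psC (a : F) : powerSeries F := poly_ps a%:P.

HB.instance Definition _ :=
  GRing.RMorphism.copy psC (@poly_ps F \o @polyC F).

Lemma pscoefC_mul a f n : pscoef (psC a * f) n = a * pscoef f n.
Proof.
rewrite /= big_ord_recl /= coefC subn0 big1 ?addr0 // => i _.
by rewrite coefC mul0r.
Qed.

Lemma pscoefX_mul k f n :
  pscoef (poly_ps 'X^k * f) n = if (n < k)%N then 0 else pscoef f (n - k).
Proof.
rewrite /=; under eq_bigr do rewrite coefXn.
case: ltnP => [ltnk | lekn].
  by rewrite big1 // => i _; rewrite ltn_eqF ?mul0r // (leq_ltn_trans (leq_ord i)).
rewrite -ltnS in lekn; rewrite (bigD1 (Ordinal lekn)) //= eqxx mul1r.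
by rewrite big1 ?addr0 // => i; rewrite -val_eqE /= => /negPf ->; rewrite mul0r.
Qed.

Lemma pscoef_sum (I : Type) (r : seq I) (G : I -> powerSeries F) n :
  pscoef (\sum_(i <- r) G i) n = \sum_(i <- r) pscoef (G i) n.
Proof. by elim/big_rec2: _ => //= i a b _ <-. Qed.

Lemma pscoefD f g n : pscoef (f + g) n = pscoef f n + pscoef g n.
Proof. by []. Qed.

Definition vanish m f := forall i, (i < m)%N -> pscoef f i = 0.

Lemma vanish_psX m f : vanish m (poly_ps 'X^m * f).
Proof. by move=> i ltim; rewrite pscoefX_mul ltim. Qed.

Lemma vanish_le m n f : (m <= n)%N -> vanish n f -> vanish m f.
Proof. by move=> lemn fn i ltim; apply: fn; apply: leq_trans lemn. Qed.

Lemma vanishM m n f g : vanish m f -> vanish n g -> vanish (m + n) (f * g).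
Proof.
move=> fm gn i ltimn /=; apply: big1 => j _.
have [ltjm | lemj] := ltnP j m; first by rewrite fm ?mul0r.
by rewrite gn ?mulr0 //; have := ltn_ord j; lia.
Qed.

Lemma vanishMl m f g : vanish m g -> vanish m (f * g).
Proof. by move=> gm; rewrite -[m]add0n; apply: vanishM. Qed.

Lemma vanish_prod (I : eqType) (r : seq I) (m : I -> nat) (G : I -> powerSeries F) :
  (forall i, i \in r -> vanish (m i) (G i)) ->
  vanish (\sum_(i <- r) m i) (\prod_(i <- r) G i).
Proof.
elim: r => [|i r IHr] Gm; first by rewrite big_nil.
rewrite !big_cons; apply: vanishM; first by apply: Gm; rewrite mem_head.
by apply: IHr => j rj; apply: Gm; rewrite in_cons rj orbT.
Qed.

Lemma vanish_poly_size m p : p != 0 -> vanish m (poly_ps p) -> (m < size p)%N.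
Proof.
move=> p0 pm; rewrite ltnNge; apply: contraNN p0 => szp.
apply/eqP/polyP => i; rewrite coef0.
by have [/pm //|lemi] := ltnP i m; rewrite nth_default // (leq_trans szp).
Qed.

Lemma vanish_poly_dvd m p : vanish m (poly_ps p) -> 'X^m %| p.
Proof.
move=> pm; have := poly_take_drop m p.
have -> : take_poly m p = 0.
  by apply/polyP => i; rewrite coef_take_poly coef0; case: ifP => // /pm.
by rewrite add0r => <-; apply: dvdp_mull.
Qed.

Lemma poly_ps_inj : injective (@poly_ps F).
Proof.
move=> p p' eqp; apply/polyP => i.
exact: (congr1 (fun f => pscoef f i) eqp).
Qed.

Lemma map_psC_horner p p' : (map_poly psC p).[poly_ps p'] = poly_ps (p \Po p').
Proof.
rewrite comp_polyE rmorph_sum (horner_coef_wide _ (size_poly _ _)).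
apply: eq_bigr => i _; rewrite coef_map /= -mul_polyC rmorphM rmorphXn.
by [].
Qed.

(** The composite f(T V): substituting a multiple of T makes sense for every V,
    and so gives a ring endomorphism with no condition on its parameter. *)
Definition ps_subst V f : powerSeries F :=
  PowerSeries (fun n => \sum_(i < n.+1) pscoef f i * pscoef (V ^+ i) (n - i)).

(** Up to any given order, composition is evaluation of a truncated polynomial;
    multiplicativity is inherited from evaluation. *)
Lemma ps_substE N V f n : (n < N)%N ->
  pscoef (ps_subst V f) n =
    pscoef (map_poly psC (ps_trunc N f)).[poly_ps 'X * V] n.
Proof.
move=> ltnN; rewrite (@horner_coef_wide _ N); last first.
  exact: leq_trans (size_poly _ _) (size_poly _ _).
rewrite pscoef_sum [LHS]/= (big_ord_widen N (fun i =>
  pscoef f i * pscoef (V ^+ i) (n - i)) ltnN) big_mkcond.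
apply: eq_bigr => i _.
rewrite coef_map coef_poly ltn_ord pscoefC_mul.
rewrite exprMn -rmorphXn pscoefX_mul ltnS.
by case: leqP; rewrite ?mulr0.
Qed.

Lemma ps_subst_poly V p :
  ps_subst V (poly_ps p) = (map_poly psC p).[poly_ps 'X * V].
Proof.
apply: psP => n; rewrite (@ps_substE (maxn n.+1 (size p))) ?leq_maxl //.
congr (pscoef (map_poly psC _).[_] n); apply/polyP => i; rewrite coef_poly /=.
by case: ifP => // /negbT; rewrite -leqNgt geq_max => /andP[_ /(nth_default 0)].
Qed.

Lemma ps_subst_is_zmod_morphism V : zmod_morphism (ps_subst V).
Proof.
move=> f g; apply: psP => n /=; rewrite -sumrB; apply: eq_bigr => i _.
by rewrite mulrBl.
Qed.

Lemma ps_trunc_mul N f g : exists r,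
  ps_trunc N f * ps_trunc N g = ps_trunc N (f * g) + r * 'X^N.
Proof.
exists (drop_poly N (ps_trunc N f * ps_trunc N g)).
rewrite -[LHS](poly_take_drop N); congr (_ + _); apply/polyP => i.
by rewrite coef_take_poly coef_poly; case: ifP => // /ps_mul_trunc ->.
Qed.

Lemma ps_subst_is_monoid_morphism V : monoid_morphism (ps_subst V).
Proof.
split=> [|f g].
  by rewrite -[1 in LHS](rmorph1 (@poly_ps F)) ps_subst_poly rmorph1 hornerC.
apply: psP => n; have [r def_r] := ps_trunc_mul n.+1 f g.
have -> : pscoef (ps_subst V f * ps_subst V g) n =
    pscoef ((map_poly psC (ps_trunc n.+1 f)).[poly_ps 'X * V] *
      (map_poly psC (ps_trunc n.+1 g)).[poly_ps 'X * V]) n.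
  apply: eq_bigr => i _; congr (_ * _); apply: ps_substE => //.
  by rewrite ltnS leq_subr.
rewrite -hornerM -rmorphM def_r (@ps_substE n.+1) // rmorphD rmorphM /=.
rewrite map_polyXn hornerD hornerM hornerXn exprMn -rmorphXn mulrCA.
by rewrite pscoefD vanish_psX ?addr0.
Qed.

HB.instance Definition _ V := GRing.isZmodMorphism.Build (powerSeries F)
  (powerSeries F) (ps_subst V) (ps_subst_is_zmod_morphism V).
HB.instance Definition _ V := GRing.isMonoidMorphism.Build (powerSeries F)
  (powerSeries F) (ps_subst V) (ps_subst_is_monoid_morphism V).

Lemma pscoefX0 V i : pscoef (V ^+ i) 0 = pscoef V 0 ^+ i.
Proof. by elim: i => [|i IHi] //; rewrite !exprS /= big_ord1 IHi. Qed.

Lemma ps_subst_eq0 V f : pscoef V 0 != 0 -> ps_subst V f = 0 -> f = 0.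
Proof.
move=> V0 Vf0; apply/eqP; apply/contraT => /ps_lead[m fm fm0].
have /eqP := congr1 (fun g => pscoef g m) Vf0.
rewrite /= big_ord_recr /= big1 ?add0r => [|i _]; last by rewrite fm0 ?mul0r.
by rewrite subnn pscoefX0 mulf_eq0 expf_eq0 (negPf fm) (negPf V0) andbF.
Qed.

End PowerSeriesOrder.

(** * Primitive linear factors over the power series ring *)

Lemma tofrac_inj (R : idomainType) : injective (@tofrac R).
Proof. by move=> x y /eqP; rewrite tofrac_eq => /eqP. Qed.

Section PrimitiveFactorization.
Variable F : fieldType.
Implicit Types (a b f : powerSeries F) (r : powerSeries F * powerSeries F).

(** A pair (a, b) stands for the point (a : b) of the projective line over
    F((T)); a primitive pair is in lowest terms and can be reduced modulo T. *)
Definition primitive_pair r := (pscoef r.1 0 != 0) || (pscoef r.2 0 != 0).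

Definition ps_eval0 f : F := pscoef f 0.

Lemma ps_eval0_is_zmod_morphism : zmod_morphism ps_eval0.
Proof. by []. Qed.
Lemma ps_eval0_is_monoid_morphism : monoid_morphism ps_eval0.
Proof. by split=> // f g; rewrite /ps_eval0 /= big_ord1. Qed.

HB.instance Definition _ := GRing.isZmodMorphism.Build (powerSeries F) F
  ps_eval0 ps_eval0_is_zmod_morphism.
HB.instance Definition _ := GRing.isMonoidMorphism.Build (powerSeries F) F
  ps_eval0 ps_eval0_is_monoid_morphism.

Lemma vanish1_psX f : pscoef f 0 = 0 -> exists g, f = poly_ps 'X * g.
Proof.
move=> f0; exists (PowerSeries (fun n => pscoef f n.+1)); apply: psP => n.
by rewrite (pscoefX_mul 1); case: n => [|n] //=; rewrite subn1.
Qed.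

Lemma laurent_primitive (z : laurent F) :
  exists r, [/\ primitive_pair r, r.2 != 0 & z = tofrac r.1 / tofrac r.2].
Proof.
have X0 : poly_ps ('X : {poly F}) != 0.
  by apply/eqP => /(congr1 (fun f => pscoef f 1)) /eqP; rewrite /= coefX oner_eq0.
have [n [f ->]] := laurentP z; elim: n f => [|n IHn] f.
  exists (f, 1); rewrite /primitive_pair /= oner_neq0 orbT.
  by rewrite rmorph1 expr0; split=> //; apply: oner_neq0.
have [/vanish1_psX[g ->] | f0] := eqVneq (pscoef f 0) 0.
  have [r [pr r20 eqr]] := IHn g; exists r; split=> //; rewrite -eqr.
  by rewrite exprS rmorphM invfM mulrACA divff ?mul1r // tofrac_eq0.
exists (f, poly_ps 'X ^+ n.+1); rewrite /primitive_pair /= f0.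
by rewrite rmorphXn; split; rewrite ?expf_neq0.
Qed.

Lemma poly_laurent_inj : injective (@poly_laurent F).
Proof. by move=> p q /tofrac_inj/poly_ps_inj. Qed.

(** Gauss' lemma for the valuation ring F[[T]]: a product of primitive linear
    factors is nonzero modulo T, so the constant C has no denominator. *)
Lemma splits_primitive (f : {poly {poly F}}) :
    f != 0 -> splits_completely (map_poly (@poly_laurent F) f) ->
  exists C rs, [/\ size rs = (size f).-1, all primitive_pair rs
    & map_poly (@poly_ps F) f = C *: \prod_(r <- rs) (r.2 *: 'X - r.1%:P)].
Proof.
move=> f0 [zs /eqpfP]; set c := _ / _ => def_f.
pose frac z := sval (cid (laurent_primitive z)).
have fracP z : [/\ primitive_pair (frac z), (frac z).2 != 0
    & z = tofrac (frac z).1 / tofrac (frac z).2].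
  by rewrite /frac; case: cid.
pose rs := map frac zs; pose P := \prod_(r <- rs) (r.2 *: 'X - r.1%:P).
pose beta := \prod_(z <- zs) tofrac (frac z).2.
have beta0 : beta != 0.
  by rewrite prodf_seq_neq0; apply/allP => z _; rewrite tofrac_eq0; case: (fracP z).
have prim_rs : all primitive_pair rs.
  by apply/allP => _ /mapP[z _ ->]; case: (fracP z).
have szP : \prod_(z <- zs) ('X - z%:P) = beta^-1 *: map_poly (@tofrac _) P.
  rewrite rmorph_prod big_map /=.
  apply: (canRL (scalerK beta0)); rewrite -mul_polyC rmorph_prod -big_split.
  apply: eq_bigr => z _ /=; case: (fracP z) => _ z20 {2}->.
  rewrite rmorphB /= map_polyC map_polyZ map_polyX mul_polyC scalerBr.
  by rewrite scale_polyC mulrC divfK // tofrac_eq0.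
have [[A B] /= [prAB B0 def_c]] := laurent_primitive (c / beta).
have eqf : B *: map_poly (@poly_ps F) f = A *: P.
  apply: (map_inj_poly (@tofrac_inj _) (rmorph0 _)); rewrite !map_polyZ /=.
  rewrite -map_poly_comp [map_poly _ f]def_f szP [c *: _]scalerA def_c scalerA.
  by congr (_ *: _); rewrite mulrC divfK // tofrac_eq0.
have P00 : map_poly ps_eval0 P != 0.
  rewrite rmorph_prod; rewrite prodf_seq_neq0; apply/allP => r /(allP prim_rs) prim_r.
  rewrite rmorphB /= map_polyC map_polyZ map_polyX; apply: contraTneq prim_r.
  move=> /polyP eqr; have := eqr 1; have := eqr 0.
  rewrite !coefB !coefZ !coefX !coefC /= mulr0 mulr1 sub0r subr0.
  by move=> /eqP; rewrite oppr_eq0 /primitive_pair => -> /eqP ->.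
have UB : B \is a GRing.unit.
  rewrite unfold_in /= /ps_unit; apply: contraTneq prAB => B00.
  rewrite /primitive_pair /= B00 eqxx orbF negbK.
  have := congr1 (map_poly ps_eval0) eqf; rewrite !map_polyZ /=.
  rewrite [ps_eval0 B]B00 scale0r => /esym/eqP.
  by rewrite scaler_eq0 (negPf P00) orbF.
exists (B^-1 * A), rs; split=> //; last first.
  by rewrite -scalerA -eqf scalerA mulVr ?scale1r.
have eq_sz : size f = size (c *: \prod_(z <- zs) ('X - z%:P)).
  rewrite -def_f; symmetry.
  exact: size_map_inj_poly poly_laurent_inj (rmorph0 _) _.
have c0 : c != 0.
  by apply: contraNneq f0 => c0; rewrite -size_poly_eq0 eq_sz c0 scale0r size_poly0.
by rewrite size_map eq_sz size_scale // size_prod_XsubC.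
Qed.
End PrimitiveFactorization.

(** * The fibres of alpha over the three rational points *)

Lemma F2P (x : 'F_2) : x = 0 \/ x = 1.
Proof. by case: x => -[|[|//]] lt_x; [left | right]; apply: val_inj. Qed.

Lemma F2_addxx (x : 'F_2) : x + x = 0.
Proof. by case: (F2P x) => ->; apply: val_inj. Qed.

Lemma F2_neq0 (x : 'F_2) : x != 0 -> x = 1.
Proof. by case: (F2P x) => ->; rewrite ?eqxx. Qed.

Implicit Types (p q : 'F_2) (r : powerSeries 'F_2 * powerSeries 'F_2).

Definition ell p q r : powerSeries 'F_2 := r.2 * psC p - r.1 * psC q.

(** For r = (a, b) this says that (a : b) is congruent to (p : q) modulo T. *)
Definition reduces_to p q r := pscoef (ell p q r) 0 == 0.

Arguments ell (p q)%_R r.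
Arguments reduces_to (p q)%_R r.

Lemma coef_ell p q r k : pscoef (ell p q r) k = pscoef r.2 k * p - pscoef r.1 k * q.
Proof.
have -> : ell p q r = psC p * r.2 - psC q * r.1 by rewrite /ell ![psC _ * _]mulrC.
by rewrite -[LHS]/(pscoef _ k - pscoef _ k) !pscoefC_mul ![_ * pscoef _ _]mulrC.
Qed.

(** The projective line over F_2 has exactly three points. *)
Lemma reduces_once r : primitive_pair r ->
  (reduces_to 0 1 r + reduces_to 1 1 r + reduces_to 1 0 r = 1)%N.
Proof.
rewrite /primitive_pair /reduces_to !coef_ell.
by case: (F2P (pscoef r.1 0)) => ->; case: (F2P (pscoef r.2 0)) => ->.
Qed.

Section Count.
Variables (d : nat) (f : {poly {poly 'F_2}}).
Variables (C : powerSeries 'F_2) (rs : seq (powerSeries 'F_2 * powerSeries 'F_2)).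
Hypothesis size_coef : forall j, (size (f`_j)%R <= d.+1)%N.
Hypothesis size_rs : size rs = (3 * d)%N.
Hypothesis prim_rs : all (@primitive_pair _) rs.
Hypothesis def_f :
  map_poly (@poly_ps _) f = C *: \prod_(r <- rs) (r.2 *: 'X - r.1%:P).

(** The form f at (p : q) is a nonzero polynomial in T of degree at most d, which
    is divisible by as many powers of T as its linear factors are. *)
Lemma vanish_sum_le p q (m : powerSeries 'F_2 * powerSeries 'F_2 -> nat) :
    hev (3 * d) f p%:P q%:P != 0 ->
    (forall r, r \in rs -> vanish (m r) (ell p q r)) ->
  (\sum_(r <- rs) m r <= d)%N.
Proof.
move=> fpq0 vm; rewrite -ltnS.
have : (\sum_(r <- rs) m r < size (hev (3 * d) f p%:P q%:P))%N.
  apply: vanish_poly_size fpq0 _.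
  rewrite hev_map def_f hevZ -size_rs hev_prod.
  by apply/vanishMl/vanish_prod.
move=> /leq_trans; apply; rewrite /hev; apply: leq_trans (size_sum _ _ _) _.
apply/bigmax_leqP => j _; rewrite -!rmorphXn -mulrA -rmorphM mulrC mul_polyC.
exact: leq_trans (size_scale_leq _ _) _.
Qed.

Hypothesis f_neq0 :
  {in [:: (0, 1); (1, 1); (1, 0)], forall c : 'F_2 * 'F_2,
    hev (3 * d) f c.1%:P c.2%:P != 0}.

(** The three fibres have at most d elements each and 3d elements together. *)
Lemma sum_reduces_to :
  {in [:: (0, 1); (1, 1); (1, 0)], forall c : 'F_2 * 'F_2,
    (\sum_(r <- rs) reduces_to c.1 c.2 r = d)%N}.
Proof.
have le_d c : c \in [:: (0, 1); (1, 1); (1, 0)] ->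
    (\sum_(r <- rs) reduces_to c.1 c.2 r <= d)%N.
  move=> Hc; apply: vanish_sum_le (f_neq0 Hc) _ => r _.
  by rewrite /reduces_to; case: eqP => [rc | _] [|i].
have : (\sum_(r <- rs) reduces_to 0 1 r + \sum_(r <- rs) reduces_to 1 1 r
        + \sum_(r <- rs) reduces_to 1 0 r = 3 * d)%N.
  rewrite -!big_split -size_rs -sum1_size; apply: eq_big_seq => r /(allP prim_rs).
  exact: reduces_once.
have all_eq a b e : (a <= d -> b <= d -> e <= d -> a + b + e = 3 * d ->
  [/\ a = d, b = d & e = d])%N by move=> *; split; lia.
move=> /(all_eq _ _ _ (le_d (0, 1) isT) (le_d (1, 1) isT) (le_d (1, 0) isT))[].
by move=> e01 e11 e10 c; rewrite !inE => /or3P[] /eqP->.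
Qed.

(** Since d simple zeros use up the whole degree of f at (p : q), no zero of the
    local equation ell at a point of this fibre is multiple. *)
Lemma reduces_to_uniformizer c r : c \in [:: (0, 1); (1, 1); (1, 0)] ->
  r \in rs -> reduces_to c.1 c.2 r -> pscoef (ell c.1 c.2 r) 1 = 1.
Proof.
move=> Hc rs_r red_r; apply: F2_neq0; apply/negP => coef1.
(* A multiple zero would count twice in the sum of the orders. *)
pose deep r := reduces_to c.1 c.2 r && (pscoef (ell c.1 c.2 r) 1 == 0).
have := @vanish_sum_le c.1 c.2 (fun r => reduces_to c.1 c.2 r + deep r)%N (f_neq0 Hc).
rewrite big_split /= sum_reduces_to // => le_d.
have {}le_d : (d + \sum_(r <- rs) deep r <= d)%N.
  apply: le_d => r' _; rewrite /deep /reduces_to.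
  by do 2 case: eqP => ? //=; case=> [|[|i]].
move: le_d; rewrite -[X in (_ <= X)%N]addn0 leq_add2l leqn0 (big_rem r) //=.
by rewrite addn_eq0 /deep red_r coef1.
Qed.
End Count.

(** * Contact of the factors with the graph of u *)

Section LocalOrders.
Variable V : powerSeries 'F_2.
Hypothesis V0 : pscoef V 0 = 1.

(** The pair (chart p p', chart q q') is the point (p + s p' : q + s q'), where s
    is the power series variable: a parametrized neighbourhood of (p : q) on the
    x-line when p q' - q p' is nonzero. *)
Definition chart (p p' : 'F_2) : powerSeries 'F_2 := psC p + poly_ps 'X * psC p'.

(** The factor b x - a at the point (X : Y), after the substitution T = s V. *)
Definition chart_ell (X Y : powerSeries 'F_2) r : powerSeries 'F_2 :=
  ps_subst V r.2 * X - ps_subst V r.1 * Y.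

Lemma ps_substC a : ps_subst V (psC a) = psC a.
Proof. by rewrite ps_subst_poly map_polyC hornerC. Qed.

Lemma coef_ps_subst f :
  [/\ pscoef (ps_subst V f) 0 = pscoef f 0,
     pscoef (ps_subst V f) 1 = pscoef f 1
   & pscoef (ps_subst V f) 2 = pscoef f 1 * pscoef V 1 + pscoef f 2].
Proof.
by split; rewrite /= !big_ord_recr big_ord0 //= add0r ?big_ord1 ?V0 /= ?expr0 ?expr1;
  rewrite /bump /= ?V0; ring.
Qed.

Lemma chart_ellE p q p' q' r :
  chart_ell (chart p p') (chart q q') r =
    ps_subst V (ell p q r) + poly_ps 'X * ps_subst V (ell p' q' r).
Proof.
by rewrite /ell !rmorphB !rmorphM /= !ps_substC /chart_ell /chart; ring.
Qed.

(** To first order the factor is s (l + m), where l is the linear coefficient of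
    ell p q r and m is the value of ell p' q' r modulo T.  Both are nonzero in
    F_2, hence equal to 1, and they cancel. *)
Lemma chart_order p q p' q' r : primitive_pair r ->
    p * q' - q * p' = 1 -> reduces_to p q r -> pscoef (ell p q r) 1 = 1 ->
  vanish 2 (chart_ell (chart p p') (chart q q') r).
Proof.
move=> prim_r det1 red_r uni_r k ltk2.
have m1 : pscoef (ell p' q' r) 0 = 1.
  apply/eqP; move: prim_r red_r det1 => + + /eqP.
  rewrite /primitive_pair /reduces_to !coef_ell.
  case: (F2P (pscoef r.1 0)) => ->; case: (F2P (pscoef r.2 0)) => -> //;
  case: (F2P p) => ->; case: (F2P q) => ->;
  by case: (F2P p') => ->; case: (F2P q') => ->.
rewrite chart_ellE pscoefD (pscoefX_mul 1).
have [s0 s1 _] := coef_ps_subst (ell p q r).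
have [t0 _ _] := coef_ps_subst (ell p' q' r).
case: k ltk2 => [|[|//]] _; first by rewrite s0 addr0 (eqP red_r).
by rewrite s1 t0 uni_r m1 F2_addxx.
Qed.

(** The coefficient of s^2 at a point over 0 is a sum of three elements of F_2,
    one of which is the linear coefficient of V; a suitable V makes it vanish. *)
Lemma chart_order3 r : reduces_to 0 1 r -> primitive_pair r ->
    pscoef (ell 0 1 r) 1 = 1 -> pscoef V 1 = pscoef r.2 1 + pscoef r.1 2 ->
  vanish 3 (chart_ell (chart 0 1) (chart 1 0) r).
Proof.
move=> red_r prim_r uni_r V1 k ltk3; have [ltk2 | ] := ltnP k 2.
  by apply: (@chart_order 0 1 1 0 r) ltk2 => //; apply: val_inj.
move=> le2k; have -> : k = 2 by lia.
rewrite chart_ellE pscoefD (pscoefX_mul 1).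
have [_ _ ->] := coef_ps_subst (ell 0 1 r).
have [_ t1 _] := coef_ps_subst (ell 1 0 r).
rewrite t1 uni_r V1 !coef_ell.
case: (F2P (pscoef r.2 1)) => ->; case: (F2P (pscoef r.1 2)) => ->;
by case: (F2P (pscoef r.2 2)) => ->; case: (F2P (pscoef r.1 1)) => ->; apply: val_inj.
Qed.
End LocalOrders.

(** * The two cubics *)

Section Contact.
Implicit Types (e : 'F_2).

(** x^3 + x + 1 and x^3 + x^2 + 1: the binary cubic forms over F_2 without
    rational zero.  The one-parameter expression lets e be chosen at the end. *)
Definition cubic e : {poly 'F_2} := 'X^3 + e *: 'X^2 + (1 + e) *: 'X + 1.
Definition quad : {poly 'F_2} := 'X^2 + 'X.

(** The power series with quad / cubic e = 'X * slope e. *)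
Definition slope e : powerSeries 'F_2 := poly_ps (1 + 'X) / poly_ps (cubic e).

Lemma coef_cubic e : [/\ (cubic e)`_0 = 1, (cubic e)`_1 = 1 + e,
  (cubic e)`_2 = e & (cubic e)`_3 = 1].
Proof.
by split; rewrite !coefD !coefZ !coefXn !coefX coef1 /=; ring.
Qed.

Lemma size_cubic e : (size (cubic e) <= 4)%N.
Proof.
apply/leq_sizeP => -[|[|[|[|j]]]] // _.
by rewrite !coefD !coefZ !coefXn !coefX coef1 /=; ring.
Qed.

Lemma size_quad : (size quad <= 4)%N.
Proof.
apply/leq_sizeP => -[|[|[|[|j]]]] // _; by rewrite !coefD coefXn coefX addr0.
Qed.

Lemma slope_cubic e : slope e * poly_ps (cubic e) = poly_ps (1 + 'X).
Proof.
by rewrite divrK // unfold_in /= /ps_unit /=; have [-> _ _ _] := coef_cubic e.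
Qed.

Lemma slope0 e : pscoef (slope e) 0 = 1.
Proof.
have /(congr1 (fun g => pscoef g 0)) := slope_cubic e.
rewrite /= big_ord1 /=; have [-> _ _ _] := coef_cubic e.
by rewrite mulr1 coefD coef1 coefX addr0.
Qed.

(** This is where the two cubics differ: e is the quadratic coefficient of u. *)
Lemma slope1 e : pscoef (slope e) 1 = e.
Proof.
have := congr1 (fun g => pscoef g 1) (slope_cubic e).
have coef1M f g : pscoef (f * g) 1 =
    pscoef f 0 * pscoef g 1 + pscoef f 1 * pscoef g 0.
  by rewrite /= !big_ord_recr big_ord0 /= add0r.
rewrite coef1M slope0; have [c0 c1 _ _] := coef_cubic e.
rewrite [pscoef (poly_ps (cubic e)) 1]c1 [pscoef (poly_ps (cubic e)) 0]c0.
move: (pscoef (slope e) 1) => v; rewrite /= coefD coef1 coefX mul1r mulr1 add0r.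
by case: (F2P e) => ->; case: (F2P v) => -> // /eqP.
Qed.

Lemma hev3E (S : comNzRingType) (p : {poly S}) X Y : hev 3 p X Y =
  p`_0 * Y ^+ 3 + p`_1 * X * Y ^+ 2 + p`_2 * X ^+ 2 * Y + p`_3 * X ^+ 3.
Proof. by rewrite /hev !big_ord_recl big_ord0 /bump /=; ring. Qed.

Lemma hev_cubic e (X Y : {poly 'F_2}) :
  hev 3 (map_poly (@psC _) (cubic e)) (poly_ps X) (poly_ps Y) =
    poly_ps (Y ^+ 3 + (1 + e)%:P * X * Y ^+ 2 + e%:P * X ^+ 2 * Y + X ^+ 3).
Proof.
rewrite hev3E !coef_map /=; have [-> -> -> ->] := coef_cubic e.
by rewrite /psC; ring.
Qed.

Lemma hev_quad (X Y : {poly 'F_2}) :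
  hev 3 (map_poly (@psC _) quad) (poly_ps X) (poly_ps Y) =
    poly_ps (X * Y * (X + Y)).
Proof.
rewrite hev3E !coef_map /= !coefD !coefXn !coefX /= !(add0r, addr0).
by rewrite /psC polyC0 polyC1; ring.
Qed.

Lemma chartE p p' : chart p p' = poly_ps (p%:P + p' *: 'X).
Proof. by rewrite -mul_polyC rmorphD rmorphM mulrC. Qed.

Lemma poly_char2 (P : {poly 'F_2}) : P + P = 0.
Proof. by apply/polyP => i; rewrite coefD coef0 F2_addxx. Qed.

Lemma chart_eq :
  [/\ chart 0 1 = poly_ps 'X, chart 1 0 = 1 & chart 1 1 = poly_ps (1 + 'X)].
Proof. by rewrite !chartE !scale1r scale0r add0r addr0 rmorph1. Qed.

(** The projective transformations x + 1 and 1 / x, which bring the points 1 and oo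
    to 0, exchange the two cubics and preserve the form x y (x + y). *)
Lemma charts_cubic e : let h := hev 3 (map_poly (@psC _) (cubic e)) in
  [/\ h (chart 0 1) (chart 1 0) = poly_ps (cubic e),
      h (chart 1 1) (chart 1 0) = poly_ps (cubic (1 + e))
    & h (chart 1 0) (chart 0 1) = poly_ps (cubic (1 + e))].
Proof.
move=> h; rewrite /h !chartE !hev_cubic !scale1r scale0r add0r addr0.
rewrite /cubic -!mul_polyC; split; congr poly_ps; first by ring.
- (* Z + Z is the difference of the two sides over the integers. *)
  set Z := 1 + e%:P + (1 + e%:P) * 'X + 'X^2.
  by rewrite -[RHS]addr0 -(poly_char2 Z) /Z; ring.
- by rewrite -[LHS]addr0 -(poly_char2 'X); ring.
Qed.

Lemma charts_quad : let h := hev 3 (map_poly (@psC _) quad) in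
  [/\ h (chart 0 1) (chart 1 0) = poly_ps quad,
      h (chart 1 1) (chart 1 0) = poly_ps quad
    & h (chart 1 0) (chart 0 1) = poly_ps quad].
Proof.
move=> h; rewrite /h !chartE !hev_quad !scale1r scale0r add0r addr0.
rewrite /quad; split; congr poly_ps; try by ring.
by rewrite -[RHS]addr0 -(poly_char2 (1 + 'X)); ring.
Qed.

Lemma slope_spec e :
  poly_ps 'X * slope e * poly_ps (cubic e) = poly_ps quad.
Proof. by rewrite -mulrA slope_cubic -rmorphM /quad; congr poly_ps; ring. Qed.

(** The substitution T = quad / cubic e, expanded at x = 0. *)
Definition slope_subst e := ps_subst (slope e) \o @poly_ps 'F_2.
HB.instance Definition _ e := GRing.RMorphism.copy (slope_subst e)
  (ps_subst (slope e) \o @poly_ps 'F_2).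

Lemma slope_substC e a : slope_subst e a%:P = psC a.
Proof. exact: ps_substC. Qed.

Lemma slope_substX e : slope_subst e 'X = poly_ps 'X * slope e.
Proof. by rewrite /slope_subst /= ps_subst_poly map_polyX hornerX. Qed.

Section Vanishing.
Variables (d : nat) (f : {poly {poly 'F_2}}).
Variables (C : powerSeries 'F_2) (rs : seq (powerSeries 'F_2 * powerSeries 'F_2)).
Hypothesis size_coef : forall j, (size (f`_j)%R <= d.+1)%N.
Hypothesis size_rs : size rs = (3 * d)%N.
Hypothesis def_f :
  map_poly (@poly_ps _) f = C *: \prod_(r <- rs) (r.2 *: 'X - r.1%:P).

(** Near a rational point of the x-line, the order of hsubst is at least the sum
    of the orders of the factors of f. *)
Lemma vanish_hsubst e e' (X Y : powerSeries 'F_2)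
    (m : powerSeries 'F_2 * powerSeries 'F_2 -> nat) :
    hev 3 (map_poly (@psC _) (cubic e)) X Y = poly_ps (cubic e') ->
    hev 3 (map_poly (@psC _) quad) X Y = poly_ps quad ->
    (forall r, r \in rs -> vanish (m r) (chart_ell (slope e') X Y r)) ->
  vanish (\sum_(r <- rs) m r)
    (hev (3 * d + 3 * d) (map_poly (@psC _) (hsubst d (3 * d) f quad (cubic e))) X Y).
Proof.
move=> hc hq vm.
rewrite (@hev_hsubst _ _ _ _ _ _ _ size_coef size_quad (size_cubic e) _
  (@psC _) (slope_subst e') X Y (slope_substC e')); last first.
  by rewrite [X in X * _ = _]slope_substX hc hq slope_spec.
apply: vanishMl; rewrite map_poly_comp /= def_f map_polyZ hevZ; apply: vanishMl.
pose rs' := [seq (ps_subst (slope e') r.1, ps_subst (slope e') r.2) | r <- rs].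
have -> : map_poly (ps_subst (slope e')) (\prod_(r <- rs) (r.2 *: 'X - r.1%:P)) =
    \prod_(r <- rs') (r.2 *: 'X - r.1%:P).
  rewrite rmorph_prod big_map; apply: eq_bigr => r _ /=.
  by rewrite rmorphB /= map_polyZ map_polyX map_polyC.
have <- : size rs' = (3 * d)%N by rewrite size_map.
by rewrite hev_prod big_map; apply: vanish_prod.
Qed.
End Vanishing.

(** Expansion at infinity reads the coefficients from the top. *)
Lemma coef_hev_inf N j (F : {poly 'F_2}) : (j <= N)%N ->
  pscoef (hev N (map_poly (@psC _) F) 1 (poly_ps 'X)) (N - j) = F`_j.
Proof.
move=> lejN; rewrite /hev pscoef_sum.
have termE i k m : pscoef ((map_poly (@psC _) F)`_i * 1 ^+ i * poly_ps 'X ^+ k) m =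
    F`_i * (m == k)%:R.
  by rewrite coef_map expr1n mulr1 -rmorphXn pscoefC_mul /= coefXn.
under eq_bigr do rewrite termE.
have ltjN : (j < N.+1)%N by [].
rewrite (bigD1 (Ordinal ltjN)) //= eqxx mulr1 big1 ?addr0 // => -[i /= ltiN].
by rewrite -val_eqE /= => neij; case: eqP => [eqij|]; rewrite ?mulr0 //; lia.
Qed.

(** A form of degree 6d on the projective line has no more than 6d zeros. *)
Lemma poly_eq0_of_vanish d (F : {poly 'F_2}) : (size F <= (6 * d).+1)%N ->
    vanish (2 * d).+1 (hev (6 * d) (map_poly (@psC _) F) (chart 0 1) (chart 1 0)) ->
    vanish (2 * d) (hev (6 * d) (map_poly (@psC _) F) (chart 1 1) (chart 1 0)) ->
    vanish (2 * d) (hev (6 * d) (map_poly (@psC _) F) (chart 1 0) (chart 0 1)) ->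
  F = 0.
Proof.
move=> szF; have szcF : (size (map_poly (@psC _) F) <= (6 * d).+1)%N.
  by apply: leq_trans szF; apply: size_poly.
have [-> -> ->] := chart_eq; rewrite !hev1r // !map_psC_horner comp_polyXr.
move=> /vanish_poly_dvd dvd0 /vanish_poly_dvd dvd1 vinf.
have {}dvd1 : (1 + 'X) ^+ (2 * d) %| F.
  have /dvdpP[G defG] := dvd1; apply/dvdpP; exists (G \Po (1 + 'X)).
  have := congr1 (fun P => P \Po (1 + 'X)) defG; rewrite comp_polyM comp_Xn_poly.
  move=> <-; rewrite -comp_polyA comp_polyD comp_polyX comp_polyC.
  by rewrite addrA poly_char2 add0r comp_polyXr.
have {}szF : (size F <= (4 * d).+1)%N.
  apply/leq_sizeP => j ltj; have [ltj6 | lej] := ltnP j (6 * d).+1; last first.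
    by rewrite nth_default // (leq_trans szF).
  by rewrite -(@coef_hev_inf (6 * d)) // vinf //; lia.
apply/eqP; apply: contraTT szF => F0; rewrite -ltnNge.
have cop : coprimep ('X^((2 * d).+1) : {poly 'F_2}) ((1 + 'X) ^+ (2 * d)).
  apply/coprimep_expl/coprimep_expr.
  by rewrite coprimep_sym coprimepX rootE !hornerE oner_eq0.
have /dvdp_leq : 'X^((2 * d).+1) * (1 + 'X) ^+ (2 * d) %| F.
  by rewrite Gauss_dvdp // dvd0.
move=> /(_ F0); apply: leq_trans.
have sz1X : size (1 + 'X : {poly 'F_2}) = 2 by rewrite addrC size_XaddC.
have pow0 : (1 + 'X) ^+ (2 * d) != 0 :> {poly 'F_2}.
  by rewrite expf_neq0 // -size_poly_eq0 sz1X.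
rewrite mulrC size_mulXn //; move: pow0; rewrite -size_poly_gt0.
have := size_exp (1 + 'X : {poly 'F_2}) (2 * d); rewrite sz1X /= mul1n.
by case: (size _) => // k /= -> _; lia.
Qed.
End Contact.

(** * The minimal polynomial meets the graph of u *)

Section GraphComponent.
Variables (d : nat) (f : {poly {poly 'F_2}}).
Variables (C : powerSeries 'F_2) (rs : seq (powerSeries 'F_2 * powerSeries 'F_2)).
Hypothesis d_gt0 : (0 < d)%N.
Hypothesis size_coef : forall j, (size (f`_j)%R <= d.+1)%N.
Hypothesis size_rs : size rs = (3 * d)%N.
Hypothesis prim_rs : all (@primitive_pair _) rs.
Hypothesis def_f :
  map_poly (@poly_ps _) f = C *: \prod_(r <- rs) (r.2 *: 'X - r.1%:P).
Hypothesis f_neq0 :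
  {in [:: (0, 1); (1, 1); (1, 0)], forall c : 'F_2 * 'F_2,
    hev (3 * d) f c.1%:P c.2%:P != 0}.

Lemma chart_order_reduces e c c' r :
    c \in [:: (0, 1); (1, 1); (1, 0)] -> c.1 * c'.2 - c.2 * c'.1 = 1 -> r \in rs ->
  vanish (2 * reduces_to c.1 c.2 r)
    (chart_ell (slope e) (chart c.1 c'.1) (chart c.2 c'.2) r).
Proof.
move=> Hc det1 rs_r; case red_r: (reduces_to _ _ r); rewrite ?muln0 // muln1.
apply: (chart_order (slope0 e) _ det1 red_r); first exact: (allP prim_rs).
exact: (reduces_to_uniformizer size_coef size_rs prim_rs def_f).
Qed.

(** The parameter e is read off from a single factor r0 over x = 0, for which it
    raises the order of contact from 2 to 3; by degree, this one extra zero
    suffices. *)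
Lemma hsubst_eq0 : exists e, hsubst d (3 * d) f quad (cubic e) = 0.
Proof.
have sum_red := sum_reduces_to size_coef size_rs prim_rs def_f f_neq0.
have [r0 rs_r0 red0] : exists2 r, r \in rs & reduces_to 0 1 r.
  apply/hasP; have /= := sum_red (0, 1) isT; apply: contra_eqT => /hasPn nored.
  rewrite big_seq big1 ?(ltn_eqF d_gt0) // => r /nored /negPf -> //.
have prim0 := allP prim_rs _ rs_r0.
have uni0 : pscoef (ell 0 1 r0) 1 = 1.
  exact: (reduces_to_uniformizer size_coef size_rs prim_rs def_f f_neq0
    (c := (0, 1))).
pose e := pscoef r0.2 1 + pscoef r0.1 2; exists e.
have [cub0 cub1 cubi] := charts_cubic e; have [quad0 quad1 quadi] := charts_quad.
have van := vanish_hsubst size_coef size_rs def_f.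
have dE : (6 * d = 3 * d + 3 * d)%N by lia.
apply: (@poly_eq0_of_vanish d); rewrite ?dE.
- exact: size_hsubst size_quad (size_cubic e).
- pose m r := (2 * reduces_to 0 1 r + (r == r0))%N.
  apply: (@vanish_le _ _ (\sum_(r <- rs) m r)); last first.
    apply: van cub0 quad0 _ => r rs_r; rewrite /m; case: eqP => [-> | _].
      by rewrite red0; apply: chart_order3; rewrite // ?slope0 ?slope1.
    rewrite addn0; apply: (@chart_order_reduces e (0, 1) (1, 0)) => //.
    by apply: val_inj.
  rewrite big_split -big_distrr /= (sum_red (0, 1) isT) (big_rem r0) //= eqxx.
  by rewrite addnA addn1 leq_addr.
- rewrite -{1}(sum_red (1, 1) isT) big_distrr /=.
  apply: (van _ _ _ _ (fun r => 2 * reduces_to 1 1 r)%N cub1 quad1) => r.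
  apply: (@chart_order_reduces (1 + e) (1, 1) (1, 0)) => //.
  by apply: val_inj.
- rewrite -{1}(sum_red (1, 0) isT) big_distrr /=.
  apply: (van _ _ _ _ (fun r => 2 * reduces_to 1 0 r)%N cubi quadi) => r.
  apply: (@chart_order_reduces (1 + e) (1, 0) (0, 1)) => //.
  by apply: val_inj.
Qed.

(** T Q(x) - (x^2 + x), the equation of the curve T = u(x). *)
Definition graph e : {poly {poly 'F_2}} :=
  'X *: map_poly polyC (cubic e) - map_poly polyC quad.

Hypothesis size_f : size f = (3 * d).+1.

Lemma coef_graph e j :
  (graph e)`_j = (cubic e)`_j *: 'X - (quad`_j)%:P.
Proof. by rewrite coefB coefZ !coef_map /= mulrC mul_polyC. Qed.

Lemma size_graph e : (1 < size (graph e))%N.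
Proof.
rewrite ltnNge; apply/negP => /leq_sizeP /(_ 3 isT) /eqP.
rewrite coef_graph; have [_ _ _ ->] := coef_cubic e.
by rewrite coefD coefXn coefX addr0 subr0 scale1r polyX_eq0.
Qed.

(** The resultant is a polynomial in T and a combination of f and graph e, which
    both vanish under T = u(x); as u is a nonconstant series, it is zero. *)
Lemma resultant_graph_eq0 : exists e, resultant f (graph e) = 0.
Proof.
have [e F0] := hsubst_eq0; exists e.
have [cub0 _ _] := charts_cubic e; have [quad0 _ _] := charts_quad.
have [chX ch1 _] := chart_eq; rewrite chX ch1 in cub0 quad0.
have f0 : (map_poly (slope_subst e) f).[poly_ps 'X] = 0.
  have := hev_hsubst (3 * d) size_coef size_quad (size_cubic e)
    (slope_substC e) (X := poly_ps 'X) (Y := 1).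
  rewrite [X in X * _ = _]slope_substX cub0 quad0 slope_spec => /(_ erefl).
  rewrite F0 rmorph0 {1}/hev big1 => [|j _]; last by rewrite coef0 !mul0r.
  rewrite hev1r => [|]; last by rewrite -size_f size_poly.
  move/esym/eqP; rewrite mulf_eq0 expf_eq0 d_gt0 /=.
  case/orP => [/eqP cub_eq0|/eqP //]; have := slope_cubic e.
  rewrite cub_eq0 mulr0 => /(congr1 (fun g => pscoef g 0)) /=.
  by rewrite coefD coef1 coefX addr0.
have g0 : (map_poly (slope_subst e) (graph e)).[poly_ps 'X] = 0.
  rewrite rmorphB /= map_polyZ /= slope_substX -!map_poly_comp.
  have eq_c : slope_subst e \o polyC =1 @psC _ by move=> a; apply: slope_substC.
  rewrite !(eq_map_poly eq_c) !(hornerE, map_psC_horner) !comp_polyXr.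
  by rewrite -(slope_spec e) /slope mulrA subrr.
have f_gt1 : (1 < size f)%N by rewrite size_f ltnS muln_gt0.
have [[u v] /= _ def_r] := resultant_in_ideal f_gt1 (size_graph e).
have : slope_subst e (resultant f (graph e)) = 0.
  have := congr1 (fun P => (map_poly (slope_subst e) P).[poly_ps 'X]) def_r.
  rewrite map_polyC hornerC => ->.
  by rewrite rmorphD !rmorphM /= !hornerE f0 g0 !mulr0 addr0.
move/ps_subst_eq0; rewrite slope0 oner_eq0 => /(_ isT) r0.
by apply: poly_ps_inj; rewrite r0 rmorph0.
Qed.
End GraphComponent.

(** * Minimal polynomials and gonality *)

Lemma irredp_common_root (F E : fieldType) (phi : {rmorphism F -> E})
    (p q : {poly F}) (x : E) :
    irreducible_poly p -> root (map_poly phi p) x -> root (map_poly phi q) x ->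
  p %| q.
Proof.
move=> [_ irr_p] px qx.
have dx : root (map_poly phi (gcdp p q)) x by rewrite gcdp_map root_gcd px.
have/eqp_dvdl <- : gcdp p q %= p; last exact: dvdp_gcdr.
apply: irr_p (dvdp_gcdl _ _); apply: contraTneq dx => /eqP/size_poly1P[c c0 ->].
by rewrite map_polyC rootC fmorph_eq0.
Qed.

Section MinimalPolynomial.
Variables (L : fieldType) (iota : {rmorphism F2T -> L}).
Implicit Types (alpha : L) (f : {poly {poly 'F_2}}).

(** Total T-adicity and the height may be witnessed by different minimal
    polynomials; as these are proportional, complete splitting passes from one to
    the other. *)
Lemma minimal_polynomial_splits alpha f f' :
    is_minimal_polynomial iota alpha f -> is_minimal_polynomial iota alpha f' ->
    splits_completely (map_poly (@poly_laurent 'F_2) f) ->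
  splits_completely (map_poly (@poly_laurent 'F_2) f').
Proof.
move=> [irr_f fx _] [irr_f' f'x _] [rs fP]; exists rs; apply: eqp_trans fP.
have : map_poly (@tofrac {poly 'F_2}) f %= map_poly (@tofrac {poly 'F_2}) f'.
  by rewrite /eqp !(irredp_common_root (phi := iota) (x := alpha)).
move/eqp_eq; rewrite !lead_coef_map_inj ?rmorph0 //; try exact: tofrac_inj.
rewrite -!map_polyZ => /(map_inj_poly (@tofrac_inj _) (rmorph0 _)) eq_ff'.
have lead0 (g : {poly {poly 'F_2}}) : irreducible_poly (map_poly (@tofrac _) g) ->
    poly_laurent (lead_coef g) != 0.
  move/irredp_neq0; apply: contraNneq; rewrite -(rmorph0 (@poly_laurent _)).
  by move=> /poly_laurent_inj/eqP; rewrite lead_coef_eq0 => /eqP ->; rewrite rmorph0.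
apply/eqpP; exists (poly_laurent (lead_coef f), poly_laurent (lead_coef f')).
  by rewrite !lead0.
by rewrite /= -!map_polyZ eq_ff'.
Qed.

Lemma size_coef_degT f j : (size (f`_j)%R <= (degT f).+1)%N.
Proof.
apply: leq_trans (leqSpred _); have [ltj | lej] := ltnP j (size f); last first.
  by rewrite nth_default // size_poly0.
exact: (leq_bigmax (Ordinal ltj)).
Qed.

Lemma third_ratio (m n : nat) : 1 / 3%:R = m%:R / n%:R :> rat ->
  (0 < m)%N /\ n = (3 * m)%N.
Proof.
have [-> | n0] := posnP n; first by rewrite invr0 mulr0.
move=> eq_mn; have nR0 : n%:R != 0 :> rat by rewrite Num.Theory.pnatr_eq0 -lt0n.
have : n%:R = (3 * m)%:R :> rat.
  by rewrite natrM -[m%:R](divfK nR0) -eq_mn; field.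
move=> /eqP; rewrite Num.Theory.eqr_nat => /eqP eqn; split=> //.
by move: n0; rewrite eqn muln_gt0.
Qed.

(** A zero value at a point with constant coordinates would be a root in F_2 (or
    a vanishing leading coefficient), against irreducibility in degree > 1. *)
Lemma irreducible_hev_neq0 n f : (1 < n)%N -> size f = n.+1 ->
    irreducible_poly (map_poly (@tofrac {poly 'F_2}) f) ->
  {in [:: (0, 1); (1, 1); (1, 0)], forall c : 'F_2 * 'F_2,
    hev n f c.1%:P c.2%:P != 0}.
Proof.
move=> n_gt1 sz_f irr_f.
have f_noroot (x : {poly 'F_2}) : f.[x] != 0.
  apply/eqP => fx0; have [_ irr] := irr_f.
  have: 'X - (tofrac x)%:P %| map_poly (@tofrac {poly 'F_2}) f.
    by rewrite dvdp_XsubCl rootE horner_map fx0 rmorph0.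
  move=> dvd_f; have := eqp_size (irr _ _ dvd_f); rewrite size_XsubC => /(_ isT).
  rewrite (size_map_inj_poly (@tofrac_inj _) (rmorph0 _)) sz_f => eq_n.
  by move: n_gt1; case: eq_n => <-.
move=> c; rewrite !inE => /or3P[] /eqP-> /=; rewrite ?polyC0 ?polyC1.
- by rewrite hev1r ?sz_f.
- by rewrite hev1r ?sz_f.
rewrite /hev (bigD1 ord_max) //= big1 => [|i].
  rewrite subnn !expr1n !mulr1 addr0 -[n]/(n.+1.-1) -sz_f lead_coef_eq0.
  by rewrite -size_poly_eq0 sz_f.
rewrite -val_eqE /= => neqi; have lti := ltn_ord i.
by rewrite expr0n subn_eq0 leqNgt ltn_neqAle neqi -ltnS lti mulr0.
Qed.

Lemma minimal_polynomial_height alpha f : is_minimal_polynomial iota alpha f ->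
    splits_completely (map_poly (@poly_laurent 'F_2) f) ->
    1 / 3%:R = (degT f)%:R / (degx f)%:R :> rat ->
  exists e, root (map_poly iota (map_poly (@tofrac _) (graph e))) alpha.
Proof.
move=> [irr_f fx _] split_f /third_ratio[d_gt0 deg_f].
have f0 : f != 0.
  by apply: contraTneq (irredp_neq0 irr_f) => ->; rewrite rmorph0 eqxx.
have sz_f : size f = (3 * degT f).+1.
  by rewrite -deg_f /degx prednK // size_poly_gt0.
have [C [rs [sz_rs prim_rs def_f]]] := splits_primitive f0 split_f.
rewrite sz_f /= in sz_rs.
have nonvan := irreducible_hev_neq0 _ sz_f irr_f.
have [|e res0] := resultant_graph_eq0 d_gt0 (size_coef_degT f) sz_rs prim_rs
  def_f (nonvan _) sz_f; first by lia.
exists e; have := resultant_eq0 f (graph e); rewrite res0 eqxx => /esym gcd_gt1.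
have dvd_map (p q : {poly {poly 'F_2}}) : p %| q ->
    map_poly (@tofrac {poly 'F_2}) p %| map_poly (@tofrac {poly 'F_2}) q.
  move=> /Pdiv.Idomain.dvdpP[[c k] /= c0 eq_q].
  rewrite -(@dvdpZr _ (tofrac c)) ?tofrac_eq0 // -map_polyZ eq_q rmorphM.
  exact: dvdp_mull.
have [_ irr] := irr_f.
have gcd_neq1 : size (map_poly (@tofrac {poly 'F_2}) (gcdp f (graph e))) != 1.
  by rewrite (size_map_inj_poly (@tofrac_inj _) (rmorph0 _)) neq_ltn gcd_gt1 orbT.
have f_dvd : map_poly (@tofrac {poly 'F_2}) f %| map_poly (@tofrac _) (graph e).
  rewrite -(eqp_dvdl _ (irr _ gcd_neq1 (dvd_map _ _ (dvdp_gcdl f (graph e))))).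
  exact/dvd_map/dvdp_gcdr.
by apply: root_dvdp fx; rewrite dvdp_map.
Qed.

Lemma varT_not_algebraic : ~ algebraicOver (constF2 iota) (iota varT).
Proof.
move=> [p p0]; have -> : map_poly (constF2 iota) p =
    map_poly iota (map_poly (@tofrac _) (map_poly polyC p)).
  by rewrite -!map_poly_comp.
rewrite /root /varT horner_map fmorph_eq0 horner_map tofrac_eq0.
by rewrite -/(p \Po 'X) comp_polyXr (negPf p0).
Qed.

HB.instance Definition _ := GRing.RMorphism.copy (constF2 iota)
  (iota \o (@tofrac {poly 'F_2} \o polyC)).

Lemma root_graph e alpha :
    root (map_poly iota (map_poly (@tofrac _) (graph e))) alpha ->
  iota varT = (map_poly (constF2 iota) quad).[alpha] /
              (map_poly (constF2 iota) (cubic e)).[alpha].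
Proof.
have mapE P : map_poly iota (map_poly (@tofrac _) (map_poly polyC P)) =
    map_poly (constF2 iota) P by rewrite -!map_poly_comp.
rewrite /graph !rmorphB /= !map_polyZ !mapE /root hornerD hornerN hornerZ.
rewrite -/varT subr_eq0 => /eqP eq_quad.
(* The denominator is 1 wherever the numerator vanishes. *)
have cubicE : cubic e = ('X + (1 + e)%:P) * quad + 1.
  by rewrite /cubic /quad -!mul_polyC -[LHS]addr0 -(poly_char2 'X^2) polyCD; ring.
have cubic_neq0 : (map_poly (constF2 iota) (cubic e)).[alpha] != 0.
  apply/eqP => cub0; have := cub0.
  rewrite cubicE rmorphD rmorphM rmorph1 hornerD hornerM -eq_quad cub0 !mulr0.
  by rewrite add0r hornerC => /eqP; rewrite oner_eq0.
by rewrite -eq_quad mulfK.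
Qed.

Lemma horner_constF2_closed (S : {pred L}) (p : {poly 'F_2}) alpha :
  divring_closed S -> alpha \in S -> (map_poly (constF2 iota) p).[alpha] \in S.
Proof.
move=> [S1 SB Sdiv] Sa; have S0 : 0 \in S by rewrite -(subrr 1) SB.
have SD x y : x \in S -> y \in S -> x + y \in S.
  by move=> Sx Sy; rewrite -[y]opprK -[- y]sub0r !SB.
have SM x y : x \in S -> y \in S -> x * y \in S.
  by move=> Sx Sy; rewrite -[y]invrK -[y^-1]div1r !Sdiv.
elim/poly_ind: p => [|p c IHp]; first by rewrite rmorph0 horner0.
rewrite rmorphD rmorphM /= map_polyX map_polyC hornerMXaddC.
by apply: SD; [apply: SM | case: (F2P c) => -> /=; rewrite ?rmorph0 ?rmorph1].
Qed.

(** T is a rational function of alpha, so alpha itself is a morphism of degree 1;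
    it is not constant because T is not. *)
Lemma gonality_le1 e alpha g :
    root (map_poly iota (map_poly (@tofrac _) (graph e))) alpha ->
  has_gonality iota alpha g -> (g <= 1)%N.
Proof.
move=> /root_graph eqT [_ min_g].
have T_in : gen_subfield [:: alpha] (iota varT).
  move=> S Sclosed Sa; rewrite eqT; have [_ _ Sdiv] := Sclosed.
  by apply: Sdiv; apply: horner_constF2_closed => //; rewrite Sa ?mem_head.
apply: min_g; exists alpha; split.
- by move=> S _; apply; rewrite !inE eqxx orbT.
- move=> alg_a; apply: varT_not_algebraic; apply/asboolP.
  apply: (T_in (fun x => `[< algebraicOver (constF2 iota) x >])).
    split=> [|x y /asboolP alg_x /asboolP alg_y|x y /asboolP alg_x /asboolP alg_y];
      apply/asboolP.
    - exact: algebraic1.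
    - exact: algebraic_sub.
    - exact: algebraic_div.
  by move=> x; rewrite inE => /eqP ->; apply/asboolP.
exists (fun=> 1) => [i S [S1 _ _] _ //|y Ky].
exists [ffun=> y]; split.
  split=> [i|]; last by rewrite big_ord1 ffunE mulr1.
  rewrite ffunE => S Sclosed Sa; apply: (Ky S Sclosed) => x; rewrite !inE.
  by case/orP=> /eqP->; [exact: T_in | rewrite Sa ?mem_head].
move=> c [_ ->]; apply/ffunP => i; rewrite ffunE big_ord1 mulr1.
by rewrite (ord1 i).
Qed.

End MinimalPolynomial.

Theorem theorem6p3 (L : closedFieldType) (iota : {rmorphism F2T -> L})
    (L_algebraic : forall x : L, algebraicOver iota x) :
  ~ exists alpha : L,
      [/\ totally_Tadic iota alpha,
          has_height iota alpha (1 / 3%:R)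
        & exists2 g : nat, has_gonality iota alpha g & g \in [:: 2; 3; 4]%N].
Proof.
case=> alpha [[f0 min_f0 split_f0] [f min_f height_f] [g gon_g]].
have split_f := minimal_polynomial_splits min_f0 min_f split_f0.
have [e root_a] := minimal_polynomial_height min_f split_f height_f.
have := gonality_le1 root_a gon_g.
by case: g {gon_g} => [|[|g]].
Qed.
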